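(* Let $\widehat{A}=A+\varepsilon B$ be an $n\times n$ dual matrix with $A,B\in\mathbb{R}^{n\times n}$, and suppose the dual core generalized inverse $\widehat{A}^{\mathrm{c}}$ of $\widehat{A}$ exists. Then $$\widehat{A}^{\mathrm{c}}=\widehat{A}^{\#}\widehat{A}\widehat{A}^{+}=A^{\mathrm{c}}+\varepsilon R,$$ where $$R=-A^{\mathrm{c}}BA^{+}+A^{\#}BA^{+}-A^{\#}BA^{\mathrm{c}}+A^{\mathrm{c}}(BA^{+})^{T}(I_n-AA^{+})+(I_n-AA^{\#})BA^{\#}A^{\mathrm{c}}.$$ Here $\widehat{A}^{\#}$ and $\widehat{A}^{+}$ are the dual group generalized inverse and the dual Moore–Penrose generalized inverse of $\widehat{A}$, and $A^{\#}$, $A^{+}$, $A^{\mathrm{c}}$ are the group, Moore–Penrose and core inverses of the real matrix $A$.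
   Context: Dual numbers are $a+\varepsilon a'$ with $a,a'\in\mathbb{R}$ and $\varepsilon\neq 0$, $\varepsilon^2=0$ (i.e. the ring $\mathbb{R}[\varepsilon]/(\varepsilon^2)$). A dual matrix is a matrix over dual numbers, written $\widehat{A}=A+\varepsilon B$ with $A,B$ real; its transpose is $\widehat{A}^{T}=A^{T}+\varepsilon B^{T}$. For an $n\times n$ dual matrix $\widehat{A}$ (each inverse below is unique when it exists): the dual core generalized inverse (DCGI) $\widehat{A}^{\mathrm{c}}$ is the $\widehat{G}$ with $\widehat{A}\widehat{G}\widehat{A}=\widehat{A}$, $\widehat{A}\widehat{G}^2=\widehat{G}$, $(\widehat{A}\widehat{G})^{T}=\widehat{A}\widehat{G}$; the dual group generalized inverse (DGGI) $\widehat{A}^{\#}$ is the $\widehat{G}$ with $\widehat{A}\widehat{G}\widehat{A}=\widehat{A}$, $\widehat{G}\widehat{A}\widehat{G}=\widehat{G}$, $\widehat{A}\widehat{G}=\widehat{G}\widehat{A}$; the dual Moore–Penrose generalized inverse (DMPGI) $\widehat{A}^{+}$ is the $\widehat{X}$ with $\widehat{A}\widehat{X}\widehat{A}=\widehat{A}$, $\widehat{X}\widehat{A}\widehat{X}=\widehat{X}$, $(\widehat{A}\widehat{X})^{T}=\widehat{A}\widehat{X}$, $(\widehat{X}\widehat{A})^{T}=\widehat{X}\widehat{A}$. For real $A$ the group, Moore–Penrose and core inverses are the real matrices defined by the same respective equations; $A^{\#}$ and $A^{\mathrm{c}}$ exist exactly when $\mathrm{rank}(A^2)=\mathrm{rank}(A)$.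 *)

(* Defs.v *)
From HB Require Import structures.
From mathcomp Require Import all_boot all_order all_algebra.
From mathcomp Require Import reals.

Set Implicit Arguments.
Unset Strict Implicit.
Unset Printing Implicit Defensive.

Import GRing.Theory.
Local Open Scope ring_scope.

(* [Dual a a'] is the dual number a + eps a'. *)
Record dual (R : Type) : Type := Dual { dre : R; ddu : R }.

Definition pair_of_dual (R : Type) (x : dual R) : R * R := (dre x, ddu x).
Definition dual_of_pair (R : Type) (x : R * R) : dual R := Dual x.1 x.2.

Lemma pair_of_dualK (R : Type) : cancel (@pair_of_dual R) (@dual_of_pair R).
Proof. by case. Qed.

HB.instance Definition _ (R : choiceType) :=
  Choice.copy (dual R) (can_type (@pair_of_dualK R)).

Section DualZmod.
Variable R : zmodType.
Implicit Types x y z : dual R.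

Definition dual0 : dual R := Dual 0 0.
Definition dual_opp x : dual R := Dual (- dre x) (- ddu x).
Definition dual_add x y : dual R := Dual (dre x + dre y) (ddu x + ddu y).

Lemma dual_addA : associative dual_add.
Proof. by move=> x y z; rewrite /dual_add /= !addrA. Qed.

Lemma dual_addC : commutative dual_add.
Proof. by move=> x y; congr Dual; apply: addrC. Qed.

Lemma dual_add0 : left_id dual0 dual_add.
Proof. by case=> a b; rewrite /dual_add /= !add0r. Qed.

Lemma dual_addN : left_inverse dual0 dual_opp dual_add.
Proof. by case=> a b; rewrite /dual_add /= !addNr. Qed.

HB.instance Definition _ :=
  GRing.isZmodule.Build (dual R) dual_addA dual_addC dual_add0 dual_addN.
End DualZmod.

Section DualRing.
Variable R : comNzRingType.
Implicit Types x y z : dual R.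

Definition dual1 : dual R := Dual 1 0.
Definition dual_mul x y : dual R :=
  Dual (dre x * dre y) (dre x * ddu y + ddu x * dre y).

Lemma dual_mulA : associative dual_mul.
Proof.
move=> x y z; congr Dual; rewrite /= ?mulrA //.
by rewrite mulrDr mulrDl !mulrA addrA.
Qed.

Lemma dual_mulC : commutative dual_mul.
Proof.
move=> x y; congr Dual; first exact: mulrC.
by rewrite addrC [ddu x * _]mulrC [dre x * _]mulrC.
Qed.

Lemma dual_mul1 : left_id dual1 dual_mul.
Proof. by case=> a b; rewrite /dual_mul /= !mul1r mul0r addr0. Qed.

Lemma dual_mulDl : left_distributive dual_mul (@dual_add R).
Proof.
move=> x y z; congr Dual; rewrite /= ?mulrDl //.
by rewrite addrACA.
Qed.

Lemma dual1_neq0 : dual1 != dual0 R.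
Proof. by apply/eqP => -[] /eqP; rewrite oner_eq0. Qed.

HB.instance Definition _ :=
  GRing.Zmodule_isComNzRing.Build (dual R)
    dual_mulA dual_mulC dual_mul1 dual_mulDl dual1_neq0.

Definition dconst (a : R) : dual R := Dual a 0.
Definition deps : dual R := Dual 0 1.

Lemma deps_neq0 : deps != 0.
Proof. by apply/eqP => -[] /eqP; rewrite oner_eq0. Qed.

Lemma deps_sqr : deps ^+ 2 = 0.
Proof. by congr Dual; rewrite /= ?mulr0 // mul0r addr0. Qed.

Lemma dualE (a a' : R) : Dual a a' = dconst a + deps * dconst a'.
Proof. by congr Dual; rewrite /= ?mul0r ?mul1r ?addr0 ?add0r. Qed.

(* The dual matrix A + eps B. *)
Definition dualmx (m n : nat) (A B : 'M[R]_(m, n)) : 'M[dual R]_(m, n) :=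
  map_mx dconst A + deps *: map_mx dconst B.

Lemma dualmxE m n (A B : 'M[R]_(m, n)) i j :
  dualmx A B i j = Dual (A i j) (B i j).
Proof. by rewrite !mxE dualE. Qed.

Lemma dualmx_tr m n (A B : 'M[R]_(m, n)) : (dualmx A B)^T = dualmx A^T B^T.
Proof. by apply/matrixP => i j; rewrite mxE !dualmxE !mxE. Qed.

Lemma dualmx_surj m n (M : 'M[dual R]_(m, n)) :
  M = dualmx (map_mx (@dre R) M) (map_mx (@ddu R) M).
Proof. by apply/matrixP => i j; rewrite dualmxE !mxE; case: (M i j). Qed.
End DualRing.

(* Over K = dual R these are the DCGI, DGGI and DMPGI; over K = R they are
   the core, group and Moore-Penrose inverses of a real matrix. *)
Section GeneralizedInverses.
Variables (K : comNzRingType) (n : nat).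
Implicit Types A G : 'M[K]_n.

Definition core_inverse A G : Prop :=
  [/\ A *m G *m A = A, A *m (G *m G) = G & (A *m G)^T = A *m G].

Definition group_inverse A G : Prop :=
  [/\ A *m G *m A = A, G *m A *m G = G & A *m G = G *m A].

Definition MP_inverse A G : Prop :=
  [/\ A *m G *m A = A, G *m A *m G = G,
      (A *m G)^T = A *m G & (G *m A)^T = G *m A].
End GeneralizedInverses.

(* Main.v *)
Require Import Defs.
From HB Require Import structures.
From mathcomp Require Import all_boot all_order all_algebra.
From mathcomp Require Import reals.
Set Implicit Arguments.
Unset Strict Implicit.
Unset Printing Implicit Defensive.
Import GRing.Theory Num.Theory.
Local Open Scope ring_scope.

(** Over any commutative ring, a core inverse [C] of [A] gives [A = A^2 C^2 A].
    If [A = A^2 Z], multiplying the Cayley-Hamilton identity of [Z] by a power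
    of [A] yields [A = Q A^2] with [Q] a polynomial in [A], so that [Q^2 A] is
    the group inverse [G] of [A].  For the Moore-Penrose inverse put [F = G A];
    then [F (1 + S^T S) = F F^T F] for [S = F - F^T], and [1 + S^T S] is
    invertible over the reals, hence over the dual numbers; this gives
    [A = A A^T U], and [U^T A C] is the Moore-Penrose inverse.

    For the explicit formula, let [E = A Ap], where [Ap] is the Moore-Penrose
    inverse of the real matrix [A].  The dual part [T] of the product of the
    dual matrix with its core inverse is symmetric and satisfies
    [T = E T + T E] and [T A = (1 - E) B], which forces
    [T = (1 - E) B Ap + (B Ap)^T (1 - E)]; the dual part of the core inverse is
    then read off from [T]. *)

Lemma strongly_regular_mx (K : comNzRingType) n (A Z : 'M[K]_n) :
  A = A *m A *m Z -> exists Q : 'M[K]_n, A = Q *m A *m A /\ Q *m A = A *m Q.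
Proof.
case: n A Z => [|n] A Z hA; first by exists 0; split; apply/matrixP => -[].
have AZ m : A ^+ m.+2 * Z = A ^+ m.+1.
  have hA2 : A ^+ 2 * Z = A by rewrite expr2; symmetry.
  by rewrite -addn2 exprD -mulrA hA2 -exprSr.
have AZn k i : A ^+ (i + k).+1 * Z ^+ i = A ^+ k.+1.
  elim: i => [|i IHi]; first by rewrite mulr1.
  by rewrite [Z ^+ _]exprS mulrA addSn AZ.
pose p := char_poly Z.
(* Multiplied by [A ^+ n.+2], a power [Z ^+ i] with [i <= n] becomes [A ^+ (n - i) * A * A] and the
   leading [Z ^+ n.+1] becomes [A]; solving for this [A] gives the witness. *)
exists (- \sum_(i < n.+1) p`_i *: A ^+ (n - i)); split; last first.
  rewrite mulNmx mulmxN mulmx_suml mulmx_sumr; congr (- _); apply: eq_bigr => i _.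
  rewrite -scalemxAl -scalemxAr; congr (_ *: _).
  by change (A ^+ (n - i) * A = A * A ^+ (n - i)); rewrite -exprSr -exprS.
have := congr1 (fun M => A ^+ n.+2 * M) (Cayley_Hamilton Z).
rewrite /= mulr0 -/p -[p in horner_mx _ p]coefK poly_def linear_sum /=.
rewrite {1}/p size_char_poly big_ord_recr /= mulrDr mulr_sumr.
have -> : p`_n.+1 = 1.
  by have /monicP := char_poly_monic Z; rewrite /lead_coef size_char_poly.
rewrite scale1r rmorphXn /= horner_mx_X.
have := AZn 0%N n.+1; rewrite addn0 expr1 => -> /eqP.
rewrite addrC addr_eq0 => /eqP {1}->; rewrite !mulNmx !mulmx_suml; congr (- _).
apply: eq_bigr => i _; rewrite linearZ rmorphXn /= horner_mx_X -scalerAr.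
rewrite -!scalemxAl; congr (_ *: _); change (A ^+ n.+2 * Z ^+ i = A ^+ (n - i) * A * A).
have le_in : (i <= n)%N by rewrite -ltnS.
have {1}-> : n.+2 = (i + (n - i).+1).+1 by rewrite addnS subnKC.
by rewrite AZn !exprSr.
Qed.

Section GeneralizedInverses.
Variables (K : comNzRingType) (n : nat).
Implicit Types A C G S X : 'M[K]_n.

Lemma core_inverse_group A C :
  core_inverse A C -> exists G, group_inverse A G.
Proof.
case=> ACA ACC _.
have [|Q [AQ QA]] := @strongly_regular_mx K n A (C *m C *m A).
  by rewrite -[A *m A *m _]mulmxA [A *m (C *m C *m A)]mulmxA ACC mulmxA ACA.
have QAX X : A *m (Q *m X) = Q *m (A *m X) by rewrite !mulmxA QA.
have AQX X : Q *m (A *m (A *m X)) = A *m X by rewrite !mulmxA -AQ.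
have AQ' : Q *m (A *m A) = A by rewrite mulmxA -AQ.
exists (Q *m Q *m A); split; rewrite -!mulmxA !(QAX, =^~ QA).
- by rewrite AQX AQ'.
- by rewrite !AQX AQ'.
- by [].
Qed.

(** [A *m C] and [A *m X] are symmetric idempotents with the range of [A], hence equal, and [G *m A]
    fixes [C = A *m (C *m C)]. This also yields uniqueness of [C]. *)
Lemma core_inverseE A C G X :
  core_inverse A C -> group_inverse A G -> MP_inverse A X -> C = G *m A *m X.
Proof.
case=> ACA ACC ACt [AGA _ AG] [AXA _ AXt _].
have -> : G *m A *m X = G *m (A *m C).
  rewrite -mulmxA; congr (G *m _); rewrite -ACt -{1}ACA -mulmxA.
  by rewrite -{1}ACt -AXt -trmx_mul mulmxA AXA.
by rewrite -ACC !mulmxA -AG AGA.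
Qed.

(** The hypothesis on [1%:M + S^T *m S] isolates what is specific to the scalars, so that reals and
    dual numbers are treated at once. *)
Lemma core_inverse_MP A C :
  (forall S, exists Y, (1%:M + S^T *m S) *m Y = 1%:M) ->
  core_inverse A C -> exists X, MP_inverse A X.
Proof.
move=> hreg hC; have [G [AGA GAG _]] := core_inverse_group hC.
case: hC => ACA ACC ACt.
pose F := G *m A.
have AF : A *m F = A by rewrite mulmxA.
have FF : F *m F = F by rewrite /F mulmxA GAG.
have FFt : F^T *m F^T = F^T by rewrite -trmx_mul FF.
have Ft : F^T = A^T *m G^T by rewrite trmx_mul.
clearbody F; have [Y zY] := hreg (F - F^T).
have Fz : F *m (1%:M + (F - F^T)^T *m (F - F^T)) = F *m F^T *m F.
  rewrite [(F - F^T)^T]linearB /= trmxK mulmxBl !mulmxBr FFt FF.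
  by rewrite mulmxDr mulmx1 !mulmxBr !mulmxA FF addrC opprB addrA !subrK.
(* [A A^T G^T = A F^T], so [A A^T U = A F F^T F Y = A F = A]. *)
pose U := G^T *m F *m Y.
have AU : A *m A^T *m U = A.
  rewrite -[A in RHS]AF -[F in RHS]mulmx1 -zY [F *m _]mulmxA Fz !mulmxA AF.
  by rewrite -[A *m A^T *m G^T]mulmxA -Ft.
(* Both sides equal [U^T A A^T U]. Thus [U^T] is an inner inverse of [A] with [U^T A] symmetric,
   while [C] is one with [A C] symmetric. *)
clearbody U; have UA : U^T *m A = A^T *m U.
  by rewrite -{1 2}AU !trmx_mul trmxK !mulmxA.
have AUA : A *m (U^T *m A) = A by rewrite UA mulmxA.
have AX : A *m (U^T *m A *m C) = A *m C by rewrite mulmxA AUA.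
have XA : U^T *m A *m C *m A = U^T *m A by rewrite -!mulmxA [A *m _]mulmxA ACA.
exists (U^T *m A *m C); split; rewrite ?AX ?XA //.
  by rewrite -mulmxA AX mulmxA.
by rewrite trmx_mul trmxK.
Qed.

End GeneralizedInverses.

Section DualMatrices.
Variable K : comNzRingType.

Lemma dualmx_inj m n (A B A' B' : 'M[K]_(m, n)) :
  dualmx A B = dualmx A' B' -> A = A' /\ B = B'.
Proof.
move=> /matrixP e; split; apply/matrixP => i j;
  by have := e i j; rewrite !dualmxE => -[].
Qed.

Lemma dualmxD m n (A B A' B' : 'M[K]_(m, n)) :
  dualmx A B + dualmx A' B' = dualmx (A + A') (B + B').
Proof. by apply/matrixP => i j; rewrite mxE !dualmxE !mxE. Qed.

Lemma dualmxM m n p (A B : 'M[K]_(m, n)) (A' B' : 'M[K]_(n, p)) :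
  dualmx A B *m dualmx A' B' = dualmx (A *m A') (A *m B' + B *m A').
Proof.
apply/matrixP => i j; rewrite dualmxE !mxE -big_split /=.
have sumD (I : Type) (r : seq I) (f : I -> dual K) :
    \sum_(k <- r) f k = Dual (\sum_(k <- r) dre (f k)) (\sum_(k <- r) ddu (f k)).
  by elim: r => [|k r IHr]; rewrite ?big_nil // !big_cons IHr.
by rewrite sumD; congr Dual; apply: eq_bigr => k _; rewrite !dualmxE.
Qed.

Lemma dualmx1 n : 1%:M = dualmx (1%:M : 'M[K]_n) 0.
Proof. by apply/matrixP => i j; rewrite dualmxE !mxE; case: eqP. Qed.

(** First-order expansion of the inverse, exact because the square of epsilon vanishes. *)
Lemma dualmx_right_inverse n (Z0 Z1 Y0 : 'M[K]_n) :
  Z0 *m Y0 = 1%:M -> exists Y, dualmx Z0 Z1 *m Y = 1%:M.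
Proof.
move=> ZY; exists (dualmx Y0 (- (Y0 *m Z1 *m Y0))).
by rewrite dualmxM ZY mulmxN !mulmxA ZY mul1mx addNr dualmx1.
Qed.

Lemma core_inverse_dre n (A B C0 C1 : 'M[K]_n) :
  core_inverse (dualmx A B) (dualmx C0 C1) -> core_inverse A C0.
Proof.
rewrite /core_inverse !dualmxM dualmx_tr.
by case=> /dualmx_inj[? _] /dualmx_inj[? _] /dualmx_inj[? _]; split.
Qed.

Lemma core_inverse_ddu n (A B C1 Ag Ap Ac : 'M[K]_n) :
  core_inverse (dualmx A B) (dualmx Ac C1) ->
  group_inverse A Ag -> MP_inverse A Ap ->
  C1 = - (Ac *m B *m Ap) + Ag *m B *m Ap - Ag *m B *m Ac
       + Ac *m (B *m Ap)^T *m (1%:M - A *m Ap)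
       + (1%:M - A *m Ag) *m B *m Ag *m Ac.
Proof.
move=> hC hG hX; have hA := core_inverse_dre hC.
have AcE := core_inverseE hA hG hX.
case: hC; rewrite !dualmxM dualmx_tr => /dualmx_inj[ACA dACA].
move=> /dualmx_inj[ACC dACC] /dualmx_inj[ACt Tt].
case: hG => AGA GAG AG; case: hX => AXA XAX AXt _.
have AE : A *m Ap = A *m Ac by rewrite AcE !mulmxA AGA.
set T := A *m C1 + B *m Ac in dACA Tt.
have AC1 : A *m C1 = T - B *m Ac by rewrite addrK.
have TD : A *m C1 + B *m Ac = T by [].
set E := A *m Ap in AXA AXt AE *; rewrite -AE in ACA dACA.
have ApE : Ap^T = E *m Ap^T by rewrite -{1}AXt -trmx_mul mulmxA XAX.
have ED : A *m Ap = E by [].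
have AgE : Ag *m E = Ac by rewrite AcE -mulmxA.
clearbody T E.
have TA : T *m A = (1%:M - E) *m B.
  by rewrite mulmxBl mul1mx -{1}dACA addrC addKr.
have TE : T *m E = (1%:M - E) *m (B *m Ap).
  by rewrite -{1}ED mulmxA TA mulmxA.
have ET : E *m T = (B *m Ap)^T *m (1%:M - E).
  by rewrite -{1}Tt -{1}AXt -trmx_mul TE trmx_mul linearB /= trmx1 AXt.
(* [E T = A C1 + E B Ac] and [T E = T A Ac], while [dACA] reads [E B + T A = B]. *)
have TT : T = E *m T + T *m E.
  rewrite -{2}TD mulmxDr AE !mulmxA -AE AXA -addrA -mulmxDl dACA.
  by rewrite TD.
have AgAc : Ag *m Ac = Ac *m Ac.
  by rewrite -{1}ACC [A *m _]mulmxA -AE mulmxA AgE.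
(* In the dual part of [A C^2 = C], the factor [1 - A Ag] kills every term beginning with [A]. *)
have kerA : (1%:M - A *m Ag) *m C1 = (1%:M - A *m Ag) *m B *m Ag *m Ac.
  rewrite -{1}dACC [LHS]mulmxDr [_ *m (A *m _)]mulmxA [_ *m A]mulmxBl mul1mx AGA subrr.
  by rewrite mul0mx add0r -!mulmxA AgAc.
have AgBAp : Ag *m (B *m Ap)^T = Ac *m (B *m Ap)^T.
  by rewrite trmx_mul {1}ApE !mulmxA AgE.
have AgT : Ag *m T = - (Ac *m B *m Ap) + Ag *m B *m Ap
                     + Ac *m (B *m Ap)^T *m (1%:M - E).
  rewrite TT ET TE mulmxDr addrC mulmxBl mul1mx [Ag *m (_ - _)]mulmxBr.
  rewrite [Ag *m (E *m _)]mulmxA [Ag *m (_^T *m _)]mulmxA AgE AgBAp !mulmxA.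
  by rewrite [_ - Ac *m B *m Ap]addrC.
(* Split along the projector [A Ag = Ag A]: [T] determines the first part, [kerA] the second. *)
have -> : C1 = Ag *m (A *m C1) + (1%:M - A *m Ag) *m C1.
  by rewrite mulmxBl mul1mx AG mulmxA addrC subrK.
by rewrite kerA AC1 mulmxBr AgT mulmxA [_ - _ + _ *m (_ - _)]addrAC.
Qed.

End DualMatrices.

(** If [v] is in the left kernel, then [v v^T + (v S^T)(v S^T)^T = 0] is a sum of squares, which
    forces [v = 0]. *)
Lemma gram_right_inverse (R : realFieldType) n (S : 'M[R]_n) :
  exists Y, (1%:M + S^T *m S) *m Y = 1%:M.
Proof.
have : row_free (1%:M + S^T *m S).
  apply: inj_row_free => v hv.
  have dot_ge0 (w : 'rV[R]_n) : 0 <= (w *m w^T) 0 0.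
    by rewrite mxE; apply: sumr_ge0 => i _; rewrite mxE -expr2 sqr_ge0.
  have : v *m v^T + (v *m S^T) *m (v *m S^T)^T = 0.
    have := congr1 (mulmx^~ v^T) hv.
    by rewrite /= mulmxDr mulmx1 mulmxDl mul0mx trmx_mul trmxK !mulmxA.
  move=> /matrixP/(_ 0 0); rewrite mxE [RHS]mxE => /eqP.
  rewrite paddr_eq0 ?dot_ge0 // => /andP[/eqP + _].
  rewrite mxE => /psumr_eq0P v0; apply/rowP => i; rewrite mxE; apply/eqP.
  rewrite -sqrf_eq0 expr2; apply/eqP; have := v0 _ i isT; rewrite mxE; apply.
  by move=> j _; rewrite mxE -expr2 sqr_ge0.
rewrite row_free_unit => u; exists (invmx (1%:M + S^T *m S)).
exact: mulmxV.
Qed.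

Lemma dual_gram_right_inverse (R : realFieldType) n (S : 'M[dual R]_n) :
  exists Y, (1%:M + S^T *m S) *m Y = 1%:M.
Proof.
rewrite [S]dualmx_surj dualmx_tr dualmxM {1}dualmx1 dualmxD.
have [Y hY] := gram_right_inverse (map_mx (@dre R) S).
exact: dualmx_right_inverse hY.
Qed.

Theorem theorem3p7 (R : realType) (n : nat) (A B : 'M[R]_n)
    (hC : exists C : 'M[dual R]_n, core_inverse (dualmx A B) C) :
  [/\ exists G : 'M[dual R]_n, group_inverse (dualmx A B) G,
      exists X : 'M[dual R]_n, MP_inverse (dualmx A B) X,
      exists Ag : 'M[R]_n, group_inverse A Ag,
      exists Ap : 'M[R]_n, MP_inverse A Ap &
      exists Ac : 'M[R]_n, core_inverse A Ac] /\
  (forall (C G X : 'M[dual R]_n) (Ag Ap Ac : 'M[R]_n),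
     core_inverse (dualmx A B) C ->
     group_inverse (dualmx A B) G ->
     MP_inverse (dualmx A B) X ->
     group_inverse A Ag ->
     MP_inverse A Ap ->
     core_inverse A Ac ->
     C = G *m dualmx A B *m X /\
     C = dualmx Ac
           (- (Ac *m B *m Ap) + Ag *m B *m Ap - Ag *m B *m Ac
            + Ac *m (B *m Ap)^T *m (1%:M - A *m Ap)
            + (1%:M - A *m Ag) *m B *m Ag *m Ac)).
Proof.


case: hC => C hC.
have [G hG] := core_inverse_group hC.
have [X hX] := core_inverse_MP (@dual_gram_right_inverse R n) hC.
have hA : core_inverse A (map_mx (@dre R) C).
  by move: hC; rewrite {1}[C]dualmx_surj => /core_inverse_dre.
have [Ag hAg] := core_inverse_group hA.
have [Ap hAp] := core_inverse_MP (@gram_right_inverse R n) hA.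
split; first by split; eexists; eassumption.
move=> C' G' X' Ag' Ap' Ac' hC' hG' hX' hAg' hAp' hAc'.
split; first exact: core_inverseE hG' hX'.
move: hC'; rewrite [C']dualmx_surj => hC'.
have hC0 := core_inverse_dre hC'.
(* Both are core inverses of [A], hence equal to [Ag' A Ap']. *)
have eC0 : map_mx (@dre R) C' = Ac'.
  by rewrite (core_inverseE hC0 hAg' hAp') (core_inverseE hAc' hAg' hAp').
rewrite eC0 in hC' *; congr dualmx.
exact: core_inverse_ddu hC' hAg' hAp'.
Qed.
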